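(* Let $R$ be an associative unital ring. If the polynomial ring $R[x]$ is a $UJ$-ring, then $R$ is a $UJ$-ring and $J(R)$ is a nil ideal of $R$.
   Context: For a unital associative ring $R$, $U(R)$ is its group of units and $J(R)$ its Jacobson radical; $R$ is a $UJ$-ring if $U(R)=1+J(R)$. An ideal is nil if all its elements are nilpotent. Rings are not assumed commutative; $R[x]$ is the polynomial ring in one indeterminate commuting with coefficients. *)

(* Defs.v *)
From HB Require Import structures.
From mathcomp Require Import all_boot all_algebra.
From mathcomp Require Import boolp classical_sets.

Set Implicit Arguments.
Unset Strict Implicit.
Unset Printing Implicit Defensive.

Import GRing.Theory.
Local Open Scope ring_scope.
Local Open Scope classical_set_scope.

(* GRing.unit is not used: it needs a unitRingType, and {poly R} carries no
   such structure unless R is an integral domain. *)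
Definition units (R : pzRingType) : set R :=
  [set u | exists v : R, u * v = 1 /\ v * u = 1].
Arguments units R : clear implicits.

Definition left_ideal (R : pzRingType) (I : set R) : Prop :=
  [/\ I 0,
      forall x y, I x -> I y -> I (x - y) &
      forall r x, I x -> I (r * x)].

Definition two_sided_ideal (R : pzRingType) (I : set R) : Prop :=
  left_ideal I /\ forall r x, I x -> I (x * r).

Definition maximal_left_ideal (R : pzRingType) (M : set R) : Prop :=
  [/\ left_ideal M,
      M <> setT &
      forall N : set R, left_ideal N -> M `<=` N -> N = M \/ N = setT].

Definition jacobson (R : pzRingType) : set R :=
  \bigcap_(M in [set M : set R | maximal_left_ideal M]) M.
Arguments jacobson R : clear implicits.

Definition UJ_ring (R : pzRingType) : Prop :=
  units R = [set 1 + j | j in jacobson R].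

Definition nilpotent_elt (R : pzRingType) (x : R) : Prop :=
  exists n : nat, x ^+ n = 0.

Definition nil_ideal (R : pzRingType) (I : set R) : Prop :=
  two_sided_ideal I /\ forall x, I x -> nilpotent_elt x.

(* Main.v *)
Require Import Defs.
From HB Require Import structures.
From mathcomp Require Import all_boot all_algebra.
From mathcomp Require Import boolp classical_sets.

(** Let [I] be the set of constants [a] of [R] lying in the Jacobson radical
    of [R[X]]. The argument shows [U(R) - 1 = I = J(R)] and that [I] is nil.

    A unit of [R] is a unit of [R[X]], so the hypothesis on [R[X]] puts [u - 1]
    in [I] for every unit [u] of [R]. The set [I] is contained in [J(R)]: if
    [1 - r a] has a left inverse in [R[X]], the constant coefficient of that
    inverse is a left inverse in [R] ([jacobson_polyC]). Since [1 + J(R)]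
    always consists of units ([jacobson_unit]), the three sets coincide.

    Finally [I] is nil because [X a] is in [J(R[X])] for [a] in [I], so
    [1 - a X] is invertible in [R[X]]; its inverse can only be the geometric
    series [1 + a X + a^2 X^2 + ...], which is a polynomial only if a power of
    [a] vanishes ([geometric_poly_nilpotent]).

    All of this rests on the elementwise description of the radical: [x] is in
    [J(R)] iff every [1 - r x] has a left inverse ([jacobsonP]), which in turn
    needs that proper left ideals lie in maximal ones (Zorn's lemma). *)

Import GRing.Theory.
Local Open Scope ring_scope.

Section Jacobson.
Local Open Scope classical_set_scope.
Variable R : pzRingType.
Implicit Types (x y r : R) (L M N : set R).

Lemma left_idealD L x y : left_ideal L -> L x -> L y -> L (x + y).
Proof.
move=> [L0 LB _] Lx Ly; rewrite -[y]opprK; apply: (LB) => //.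
by rewrite -[- y]sub0r; apply: LB.
Qed.

Lemma left_ideal1 L : left_ideal L -> L 1 -> L = setT.
Proof.
move=> [_ _ LM] L1; apply/seteqP; split => // x _.
by rewrite -[x]mulr1; apply: LM.
Qed.

Lemma left_ideal_principal x : left_ideal [set r * x | r in setT].
Proof.
split; first by exists 0 => //; rewrite mul0r.
- by move=> _ _ [r _ <-] [s _ <-]; exists (r - s) => //; rewrite mulrBl.
- by move=> s _ [r _ <-]; exists (s * r) => //; rewrite mulrA.
Qed.

Lemma left_ideal_add L N : left_ideal L -> left_ideal N ->
  left_ideal [set x + y | x in L & y in N].
Proof.
move=> [L0 LB LM] [N0 NB NM]; split.
- by exists 0 => //; exists 0 => //; rewrite addr0.
- move=> _ _ [x Lx [y Ny <-]] [x' Lx' [y' Ny' <-]].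
  exists (x - x'); first exact: LB.
  by exists (y - y'); [exact: NB | rewrite opprD addrACA].
- move=> r _ [x Lx [y Ny <-]]; exists (r * x); first exact: LM.
  by exists (r * y); [exact: NM | rewrite mulrDr].
Qed.

(** Zorn's lemma is applied to the sets [A] such that [A `|` L] is a proper left
    ideal, rather than to the proper left ideals containing [L], so that the
    union of the empty chain is admissible too. *)
Lemma exists_maximal_left_ideal L : left_ideal L -> ~ L 1 ->
  exists2 M, maximal_left_ideal M & L `<=` M.
Proof.
move=> idL L1.
have [|A [[idA A1] maxA]] :=
  @Zorn_bigcup R [set A | left_ideal (A `|` L) /\ ~ (A `|` L) 1].
- move=> F FP totF; split; last first.
    by case=> [[A FA A1]|//]; have [_] := FP _ FA; apply; left.
  have [L0 LB LM] := idL; split; first by right.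
  + move=> x y [[A FA Ax]|Lx] [[B FB By]|Ly]; last by right; apply: LB.
    * have [C FC [Cx Cy]] : exists2 C, F C & C x /\ C y.
        have [AB|BA] := totF _ _ FA FB; first by exists B => //; split=> //; exact: AB.
        by exists A => //; split=> //; exact: BA.
      have [[_ CB _] _] := FP _ FC.
      have [Cxy|Lxy] := CB x y (or_introl Cx) (or_introl Cy); last by right.
      by left; exists C.
    * have [[_ AB _] _] := FP _ FA.
      have [Axy|Lxy] := AB x y (or_introl Ax) (or_intror Ly); last by right.
      by left; exists A.
    * have [[_ BB _] _] := FP _ FB.
      have [Bxy|Lxy] := BB x y (or_intror Lx) (or_introl By); last by right.
      by left; exists B.
  + move=> r x [[A FA Ax]|Lx]; last by right; apply: LM.
    have [[_ _ AM] _] := FP _ FA.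
    have [Arx|Lrx] := AM r x (or_introl Ax); last by right.
    by left; exists A.
exists (A `|` L); last by move=> x; right.
split=> //; first by move=> AT; apply: A1; rewrite AT.
move=> N idN AN; have [N1|N1] := pselect (N 1).
  by right; apply: left_ideal1.
left; apply/seteqP; split=> //.
have [NA|NA] := pselect (N `<=` A); first by move=> x Nx; left; apply: NA.
case: (maxA N); first by split=> // x Ax; apply: AN; left.
by rewrite /mkset (_ : N `|` L = N) //; apply/setUidl => x Lx; apply: AN; right.
Qed.

(** If [x] is outside a maximal [M], then [1 = m + r x] with [m] in [M], and
    [m = 1 - r x] cannot be left invertible. Conversely, if [1 - r x] is not
    left invertible, it lies in a maximal left ideal, which cannot contain [x]
    as it would then contain [1]. *)
Lemma jacobsonP x :
  jacobson R x <-> forall r, exists v, v * (1 - r * x) = 1.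
Proof.
split=> [Jx r|Jx M maxM].
  apply: contrapT => nv.
  have [|M maxM sM] := exists_maximal_left_ideal _ (left_ideal_principal (1 - r * x)).
    by move=> [v _ vE]; apply: nv; exists v.
  have [idM MT _] := maxM; apply: MT; apply: left_ideal1 => //.
  have [_ _ MM] := idM.
  rewrite -[1](subrK (r * x)); apply: left_idealD => //.
    by apply: sM; exists 1 => //; rewrite mul1r.
  by apply: MM; apply: Jx.
have [idM MT Mmax] := maxM; have [M0 MB MM] := idM.
have idN := left_ideal_add _ _ idM (left_ideal_principal x).
have [|NM|NT] := Mmax _ idN.
- by move=> y My; exists y => //; exists 0; [exists 0 => //; rewrite mul0r | rewrite addr0].
- rewrite -NM; exists 0 => //; exists x; last by rewrite add0r.
  by exists 1 => //; rewrite mul1r.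
have [m Mm [_ [r _ <-] E]] : [set a + y | a in M & y in [set r * x | r in setT]] 1.
  by rewrite NT.
have [v vE] := Jx r.
case: MT; apply: left_ideal1 => //.
by rewrite -vE -E addrK; apply: MM.
Qed.

Lemma jacobson_left_ideal : left_ideal (jacobson R).
Proof.
split=> [M [[]]//|x y Jx Jy M maxM|r x Jx M maxM];
  have [[_ MB MM] _ _] := maxM.
- by apply: MB; [apply: Jx | apply: Jy].
- by apply: MM; apply: Jx.
Qed.

(** Left invertibility of [1 - a b] passes to [1 - b a]: if [v] inverts the
    former then [1 + b v a] inverts the latter. This moves a right factor of
    [x] to its left, where [jacobsonP] absorbs it. *)
Lemma jacobson_two_sided : two_sided_ideal (jacobson R).
Proof.
split; first exact: jacobson_left_ideal.
move=> r x /jacobsonP Jx; apply/jacobsonP => s.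
have [v vE] := Jx (r * s).
exists (1 + s * x * v * r).
have -> : (1 + s * x * v * r) * (1 - s * (x * r)) =
    1 - s * x * r + s * x * (v * (1 - r * s * x)) * r.
  by rewrite mulrDl mul1r !mulrBr !mulrBl !mulr1 !mulrA.
by rewrite vE mulr1 subrK.
Qed.

(** The left inverse [v] of [1 + x] equals [1 - v x], so it is itself left
    invertible and hence two-sided. *)
Lemma jacobson_unit x : jacobson R x -> units R (1 + x).
Proof.
move=> Jx; have [v vE] := (jacobsonP x).1 Jx (-1).
rewrite mulN1r opprK in vE.
have [w wE] := (jacobsonP x).1 Jx v.
have vE' : 1 - v * x = v by rewrite -vE mulrDr mulr1 addrK.
rewrite vE' in wE; exists v; split=> //.
suff -> : 1 + x = w by [].
by rewrite -[LHS]mul1r -{1}wE -mulrA vE mulr1.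
Qed.

End Jacobson.

Section PolyJacobson.
Variable R : nzRingType.

Lemma polyC_unit (u : R) : units R u -> units {poly R} u%:P.
Proof. by move=> [v [uv vu]]; exists v%:P; rewrite -!polyCM uv vu. Qed.

Lemma jacobson_polyC (a : R) : jacobson {poly R} a%:P -> jacobson R a.
Proof.
move=> /jacobsonP Ja; apply/jacobsonP => r.
have [v vE] := Ja r%:P; exists v`_0.
have := congr1 (fun p : {poly R} => p`_0) vE.
by rewrite -polyCM -polyC1 -polyCB coefMC coefC.
Qed.

(** Comparing coefficients, [v] starts with [1] and each coefficient is the
    previous one times [a], so [v] is the geometric series of [a X]; being a
    polynomial, it stops. *)
Lemma geometric_poly_nilpotent (a : R) (v : {poly R}) :
  v * (1 - a%:P * 'X) = 1 -> nilpotent_elt a.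
Proof.
move=> vE; exists (size v).
suff coefv n : v`_n = a ^+ n by rewrite -coefv nth_default.
have {}vE : v = 1 + v * a%:P * 'X by rewrite -{1}vE mulrBr mulr1 mulrA subrK.
elim: n => [|n IHn]; rewrite vE coefD coef1 coefMX /= ?addr0 //.
by rewrite coefMC IHn add0r exprSr.
Qed.

Lemma jacobson_polyC_nilpotent (a : R) :
  jacobson {poly R} a%:P -> nilpotent_elt a.
Proof.
move=> /jacobsonP Ja; have [v] := Ja 'X.
by rewrite -commr_polyX => /geometric_poly_nilpotent.
Qed.

End PolyJacobson.

Theorem proposition2p5 (R : nzRingType) :
  UJ_ring {poly R} -> UJ_ring R /\ nil_ideal (jacobson R).
Proof.
move=> UJ.
have unit_sub1 (u : R) : units R u -> jacobson {poly R} (u - 1)%:P.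
  move=> /polyC_unit; rewrite UJ => -[j Jj uE].
  by rewrite polyCB -uE addrC addKr.
split.
  apply/seteqP; split=> [u Uu|_ [j Jj <-]]; last exact: jacobson_unit.
  by exists (u - 1); [exact: jacobson_polyC _ _ (unit_sub1 _ Uu) | rewrite addrC subrK].
split; first exact: jacobson_two_sided.
move=> j /jacobson_unit /unit_sub1.
by rewrite addrC addKr => /jacobson_polyC_nilpotent.
Qed.
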